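(* Let $m\geq 2$ be square-free and let $d\geq k\geq 2$ be integers. Let $f(x)=\sum_{i=k}^d a_ix^i\in\mathbb{Z}[x]$ with $a_d\neq 0$ and $\gcd(a_k,m)=1$, and suppose that zero is the only root of $f$ modulo $m$ (i.e. $f(x)\equiv 0\pmod m$ implies $x\equiv 0\pmod m$). Let $R\subseteq\{0,1,\dots,m-1\}$ be a set such that for all distinct $r,r'\in R$, $r-r'$ is not congruent modulo $m$ to any $k$th power $x^k$, $x\in\mathbb{Z}$. Let \[\gamma=\frac{d-1+\log_m|R|}{d}.\] Then there is a constant $c>0$ depending only on $m$ and $f$ such that for every positive integer $N$ there exists a set $A\subseteq[N]$ with $(A-A)\cap f(\mathbb{Z})=\{0\}$ and $|A|\geq cN^{\gamma}$.
   Context: $[N]=\{1,2,\dots,N\}$; $A-A=\{a-a':a,a'\in A\}$; $f(\mathbb{Z})=\{f(x):x\in\mathbb{Z}\}$. *)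

(* Defs.v *)
From HB Require Import structures.
From mathcomp Require Import all_boot all_order all_algebra finmap.
From mathcomp Require Import all_classical all_reals all_analysis.

Set Implicit Arguments.
Unset Strict Implicit.
Unset Printing Implicit Defensive.

Import Order.TTheory GRing.Theory Num.Theory.

Definition squarefree (m : nat) : Prop :=
  forall s : nat, (s ^ 2 %| m)%N -> s = 1%N.

Local Open Scope ring_scope.
Local Open Scope classical_set_scope.

Definition difference_set (A : {fset int}) : set int :=
  [set x | exists a b : int, [/\ a \in A, b \in A & x = a - b]].

Definition value_set (f : {poly int}) : set int :=
  range (fun x : int => f.[x]).

(* log_m |R| is ln |R| / ln m; as ln 0 = 0, an empty R gets the same value as
   a one-element R. *)
Definition gamma_exponent (K : realType) (m d : nat) (R : {set 'I_m}) : K :=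
  (d%:R - 1 + ln (#|R|%:R) / ln (m%:R)) / d%:R.

(* Main.v *)
(** Write integers in base m, with m^n <= N < m^(n+1). If a nonzero x has
    x = m^i y with m not dividing y, then f(x) = m^(ki) (a_k y^k + m z) when
    i > 0, while m does not divide f(x) when i = 0. So if a - a' = f(x) <> 0,
    the lowest digit at which a and a' differ is at position 0 or ki, and in
    the latter case the digits differ by a_k y^k modulo m. Hence it suffices to
    fix digit 0 and to take the digits at positions ki in a_k R modulo m.
    Moreover |x|^d = O(|f(x)|) = O(m^n), so only the i <= n/d + O(1) matter:
    about n/d digits are restricted to |R| values and all others are free. *)

Require Import Defs.
From HB Require Import structures.
From mathcomp Require Import all_boot all_order all_algebra finmap.
From mathcomp Require Import all_classical all_reals all_analysis.
From mathcomp Require Import zify ring lra.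

Set Implicit Arguments.
Unset Strict Implicit.
Unset Printing Implicit Defensive.

Import Order.TTheory GRing.Theory Num.Theory.
Local Open Scope ring_scope.
Local Open Scope classical_set_scope.

(** * Divisibility and factoring out powers of [m] *)

Lemma PoszX (a b : nat) : (a ^ b)%N%:Z = a%:Z ^+ b.
Proof. by rewrite -natz natrX natz. Qed.

(** Each prime divisor of a square-free [m] occurs in it to the first power only, so it suffices
    that each of these primes divides [y]. *)
Lemma squarefree_dvdn_exp (m y k : nat) :
  (0 < m)%N -> squarefree m -> (m %| y ^ k)%N -> (m %| y)%N.
Proof.
move=> m0 sqm; have [->|y0] := posnP y; first by rewrite dvdn0.
have yk0 : (0 < y ^ k)%N by rewrite expn_gt0 y0.
move=> /(dvdn_partP _ m0) H; apply/(dvdn_partP _ m0) => p /[dup] pm /H.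
move: pm; rewrite mem_primes => /and3P[pp _ pm].
have lm : logn p m = 1%N.
  apply/eqP; rewrite eqn_leq logn_gt0 mem_primes pp m0 pm !andbT leqNgt.
  apply/negP => h; have /sqm : (p ^ 2 %| m)%N by rewrite pfactor_dvdn.
  by move=> p1; rewrite p1 in pp.
rewrite p_part lm expn1 Euclid_dvdX //; by case/andP.
Qed.

Lemma squarefree_dvdz_exp (m : nat) (y : int) (k : nat) :
  (0 < m)%N -> squarefree m -> (m%:Z %| y ^+ k)%Z -> (m%:Z %| y)%Z.
Proof. by move=> m0 sqm; rewrite !dvdzE abszX; apply: squarefree_dvdn_exp. Qed.

Lemma dvdz_max_exp (m : nat) (x : int) : (1 < m)%N -> x != 0 ->
  exists i (y : int), x = m%:Z ^+ i * y /\ ~~ (m%:Z %| y)%Z.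
Proof.
move=> m1; have [b] := ubnP `|x|%N; elim: b x => // b IH x xb x0.
have [|mx] := boolP (m%:Z %| x)%Z; last by exists 0%N, x; rewrite mul1r.
case/dvdzP=> q xE; have q0 : q != 0.
  by apply: contraNneq x0 => q0; rewrite xE q0 mul0r.
have [|i [y [qE my]]] := IH q _ q0.
  have : (0 < `|q|)%N by rewrite absz_gt0.
  by move: xb; rewrite xE abszM /=; nia.
by exists i.+1, y; split=> //; rewrite xE qE exprS; ring.
Qed.

(** Cancelling the smaller power leaves a factor [m] on one side unless the exponents agree. This
    serves to identify the lowest position where two digit expansions differ. *)
Lemma eq_max_exp (m i j : nat) (u v : int) : (1 < m)%N ->
  ~~ (m%:Z %| u)%Z -> ~~ (m%:Z %| v)%Z ->
  m%:Z ^+ i * u = m%:Z ^+ j * v -> i = j /\ u = v.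
Proof.
move=> m1; have mn0 n : m%:Z ^+ n != 0 by rewrite expf_neq0 //; lia.
wlog ij : i j u v / (i <= j)%N.
  move=> H nu nv e; have [ij|/ltnW ji] := leqP i j; first exact: H.
  by have [-> ->] := H _ _ _ _ ji nv nu (esym e).
move=> nu nv; rewrite -{1}(subnKC ij) exprD -mulrA => /(mulfI (mn0 _)).
case E : (j - i)%N => [|n] uE; last first.
  by case/negP: nu; rewrite uE exprS -mulrA dvdz_mulr.
by split; [lia | rewrite uE mul1r].
Qed.

(** * Integers with prescribed base-[m] digit sets *)

(** [A] collects the sums of [m ^ j * b] with one digit [b] from each [D j], built by adding top
    digits. In the last clause [j] is the lowest position where [a] and [a'] differ, and [q] absorbs
    everything above it. *)
Lemma digit_seq (m n : nat) (D : nat -> seq int) : (1 < m)%N ->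
  (forall j, uniq (D j)) -> (forall j b, b \in D j -> 0 <= b < m%:Z) ->
  exists A : seq int,
    [/\ uniq A, size A = \prod_(0 <= j < n) size (D j),
        forall a, a \in A -> 0 <= a < m%:Z ^+ n &
        forall a a', a \in A -> a' \in A -> a != a' ->
          exists j b b' q, [/\ (j < n)%N, b \in D j, b' \in D j, b != b' &
            a - a' = m%:Z ^+ j * (b - b' + m%:Z * q)]].
Proof.
move=> m1 uD bD; elim: n => [|n [A [uA sA bA dA]]].
  exists [:: 0]; split=> //; first by rewrite big_nil.
    by move=> a; rewrite inE => /eqP->.
  by move=> a a'; rewrite !inE => /eqP-> /eqP->; rewrite eqxx.
have mn : 0 < m%:Z ^+ n by rewrite exprn_gt0 //; lia.
exists [seq a + m%:Z ^+ n * b | a <- A, b <- D n]; split.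
- apply: allpairs_uniq => // ? ? /allpairsP[[a b] /= [aA _ ->]].
  move=> /allpairsP[[a' b'] /= [a'A _ ->]] /= e.
  move: (bA _ aA) (bA _ a'A) => ba ba'.
  move: mn ba ba' e; clear; move: (_ ^+ n) => M M0 ba ba' e.
  have bb : b = b' by nia.
  by move: e; rewrite bb => /addIr ->.
- by rewrite size_allpairs sA big_nat_recr.
- move=> x /allpairsP[[a b] /= [/bA aA /bD bn ->]].
  by rewrite exprSr; set M := _ ^+ n in mn aA *; nia.
move=> x x' /allpairsP[[a b] /= [aA bn ->]] /allpairsP[[a' b'] /= [a'A b'n ->]].
have [<-|aa' _] := eqVneq a a'.
  move=> ne; exists n, b, b', 0; split=> //; last by ring.
  by apply: contraNneq ne => ->.
have [j [c [c' [q [jn cD c'D cc' e]]]]] := dA _ _ aA a'A aa'.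
(* The new top digits sit above position [j], so they only change [q]. *)
exists j, c, c', (q + m%:Z ^+ (n - j.+1) * (b - b')); split=> //; first exact: ltnW.
have -> : m%:Z ^+ n = m%:Z ^+ j * (m%:Z * m%:Z ^+ (n - j.+1)).
  by rewrite -exprS -exprD; congr (_ ^+ _); lia.
have -> : forall u v w z : int, u + z * v - (w + z * b') = (u - w) + z * (v - b').
  by move=> *; ring.
by rewrite e; ring.
Qed.

(** * Growth and divisibility of polynomial values *)

Lemma horner_growth (p : {poly int}) (d : nat) : size p = d.+1 -> (0 < d)%N ->
  exists C : nat, forall x : int, p.[x] != 0 -> `|x| ^+ d <= C%:Z * `|p.[x]|.
Proof.
case: d => // d sp _; pose S : int := \sum_(i < d.+1) `|p`_i|.
have S0 : 0 <= S by apply: sumr_ge0.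
(* For [|x| > 2 * S] the lower terms are at most half the leading one, and the constant 2 suffices.
   For smaller [x] the other summand does, since a nonzero integer value is at least 1 in absolute
   value. *)
pose C : int := 2 + (2 * S) ^+ d.+1; exists `|C|%N => x px0.
have C0 : 0 <= (2 * S) ^+ d.+1 by rewrite exprn_ge0 // mulr_ge0.
have px1 : 1 <= `|p.[x]| by move: px0; lia.
rewrite gez0_abs ?addr_ge0 // /C.
have [xS|Sx] := leP `|x| (2 * S).
  have : `|x| ^+ d.+1 <= (2 * S) ^+ d.+1 by rewrite lerXn2r ?nnegrE ?mulr_ge0.
  by nia.
have x1 : 1 <= `|x| by lia.
have pd : p`_d.+1 != 0.
  have : lead_coef p != 0 by rewrite lead_coef_eq0 -size_poly_eq0 sp.
  by rewrite /lead_coef sp.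
have low : `|\sum_(i < d.+1) p`_i * x ^+ i| <= S * `|x| ^+ d.
  rewrite mulr_suml; apply: le_trans (ler_norm_sum _ _ _) _.
  apply: ler_sum => i _; rewrite normrM normrX ler_wpM2l //.
  by apply: ler_weXn2l => //; rewrite -ltnS.
have pxE : p.[x] = \sum_(i < d.+1) p`_i * x ^+ i + p`_d.+1 * x ^+ d.+1.
  by rewrite horner_coef sp big_ord_recr.
have high : `|x| ^+ d.+1 <= `|p`_d.+1 * x ^+ d.+1|.
  by rewrite normrM normrX ler_peMl ?exprn_ge0 //; lia.
have tri : `|p`_d.+1 * x ^+ d.+1| <= `|p.[x]| + S * `|x| ^+ d.
  by move: low; rewrite pxE; lia.
have xd : 0 <= `|x| ^+ d by rewrite exprn_ge0.
move: high tri; rewrite exprS; nia.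
Qed.

(** A term of degree [j > k] is divisible by [m ^ (i * j)], and [i * j >= k * i + 1] because
    [i > 0]. *)
Lemma horner_max_exp (m k d i : nat) (f : {poly int}) (y : int) :
  (k <= d)%N -> f = \sum_(k <= j < d.+1) f`_j *: 'X^j -> (0 < i)%N ->
  exists z : int,
    f.[m%:Z ^+ i * y] = m%:Z ^+ (k * i) * (f`_k * y ^+ k + m%:Z * z).
Proof.
move=> kd fE i0; set x := _ * y.
have -> : f.[x] = f`_k * x ^+ k + \sum_(k.+1 <= j < d.+1) f`_j * x ^+ j.
  rewrite {1}fE horner_sum big_ltn // hornerZ hornerXn; congr (_ + _).
  by apply: eq_bigr => j _; rewrite hornerZ hornerXn.
have /dvdzP[z ->] :
    (m%:Z ^+ (k * i).+1 %| \sum_(k.+1 <= j < d.+1) f`_j * x ^+ j)%Z.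
  rewrite big_nat; apply: rpred_sum => j /andP[kj _].
  rewrite dvdz_mull // exprMn dvdz_mulr // -exprM dvdz_exp2l //.
  by nia.
by exists z; rewrite /x exprMn -exprM mulnC exprS; ring.
Qed.

(** * Counting with restricted digits *)

(** The factor [m ^ count c s] on the left avoids a subtraction in the exponent of [m]. *)
Lemma prod_if_count (T : Type) (s : seq T) (c : pred T) (r m : nat) :
  (\prod_(j <- s) (if c j then r else m) * m ^ count c s =
   r ^ count c s * m ^ size s)%N.
Proof.
elim: s => [|j s IH]; first by rewrite big_nil.
rewrite big_cons /= expnS; case: (c j); last first.
  by rewrite add0n -mulnA IH; ring.
by rewrite add1n !expnS -[RHS]mulnACA -IH; ring.
Qed.

(** At most [P] positions are restricted, being multiples [k * i] with [i < P]; as [r <= m], having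
    fewer of them only enlarges the product. *)
Lemma restricted_prod (m k n P r : nat) : (0 < k)%N -> (0 < r <= m)%N ->
  (m ^ n * r ^ P <=
   m ^ P * \prod_(0 <= j < n) (if (k %| j) && (j %/ k < P) then r else m))%N.
Proof.
move=> k0 /andP[r0 rm]; pose c j := (k %| j)%N && (j %/ k < P)%N.
change (m ^ n * r ^ P <= m ^ P * \prod_(0 <= j < n) (if c j then r else m))%N.
have cP : (count c (index_iota 0 n) <= P)%N.
  rewrite -size_filter -(size_iota 0 P) -[leqRHS](size_map (muln k)).
  apply: uniq_leq_size; first by rewrite seq.filter_uniq // iota_uniq.
  move=> j; rewrite mem_filter => /andP[/andP[kj jP] _].
  apply/mapP; exists (j %/ k)%N; first by rewrite mem_iota.
  by rewrite mulnC divnK.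
have := prod_if_count (index_iota 0 n) c r m.
rewrite size_iota subn0; set e := count _ _ in cP *; set X := \prod_(_ <- _) _.
move=> E; rewrite -(subnK cP) !expnD.
have -> : (m ^ (P - e) * m ^ e * X = m ^ (P - e) * (X * m ^ e))%N by ring.
rewrite E [leqLHS](_ : _ = r ^ (P - e) * (r ^ e * m ^ n))%N; last by ring.
rewrite leq_mul2r; have [->|Pe0] := posnP (P - e)%N; first by rewrite orbT.
by rewrite leq_exp2r // rm orbT.
Qed.

(** * The construction below a power of [m] *)

Lemma polynomial_free_seq (m k d C t n : nat) (f : {poly int}) (R : seq int) :
  (1 < m)%N -> squarefree m -> (0 < k)%N -> (k <= d)%N ->
  f = \sum_(k <= i < d.+1) f`_i *: 'X^i ->
  coprimez f`_k m%:Z ->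
  (forall x : int, (m%:Z %| f.[x])%Z -> (m%:Z %| x)%Z) ->
  (forall x : int, f.[x] != 0 -> `|x| ^+ d <= C%:Z * `|f.[x]|) ->
  (C <= m ^ t)%N ->
  uniq R -> (forall r, r \in R -> 0 <= r < m%:Z) -> (0 < size R)%N ->
  (forall r r', r \in R -> r' \in R -> r != r' ->
     forall x : int, (r - r' != x ^+ k %[mod m%:Z])%Z) ->
  exists A : seq int,
    [/\ uniq A, forall a, a \in A -> 0 <= a < m%:Z ^+ n,
        forall a a' x, a \in A -> a' \in A -> a - a' = f.[x] -> a = a' &
        (m ^ n * size R ^ ((n + t) %/ d).+1 <=
         size A * m ^ ((n + t) %/ d).+2)%N].
Proof.
move=> m1 sqm k0 kd fE fk froot fC Cmt uR bR R0 sepR.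
have m0 : (0 < m)%N by lia.
have mz0 : m%:Z != 0 by lia.
have d0 : (0 < d)%N by lia.
(* If [m ^ i] divides [x], then [m ^ (i * d) <= |x| ^ d <= C * |f(x)| <= m ^ (t + n)], which gives
   [i < P]. *)
set P := ((n + t) %/ d).+1.
pose c j := (k %| j)%N && (j %/ k < P)%N.
(* Scaling by the unit [f_k] matches the leading factor of [f(x)], so that it cancels at the end. *)
pose aR := [seq (f`_k * r %% m%:Z)%Z | r <- R].
pose full := [seq i%:Z | i <- iota 0 m].
pose D j := if j == 0%N then [:: 0] else if c j then aR else full.
have dvd_small r r' : 0 <= r < m%:Z -> 0 <= r' < m%:Z ->
    (m%:Z %| r - r')%Z -> r = r'.
  by move=> hr hr'; rewrite -eqz_mod_dvd !modz_small // => /eqP.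
have uD j : uniq (D j).
  rewrite /D; case: eqP => // _; case: ifP => _.
    rewrite map_inj_in_uniq // => r r' /bR hr /bR hr' /eqP.
    rewrite eqz_mod_dvd -mulrBr Gauss_dvdzr; first exact: dvd_small.
    by rewrite coprimez_sym.
  by rewrite map_inj_uniq ?iota_uniq // => i i' [].
have bD j b : b \in D j -> 0 <= b < m%:Z.
  rewrite /D; case: eqP => _; first by rewrite inE => /eqP->; lia.
  case: ifP => _ /mapP[r rR ->]; first by rewrite modz_ge0 // ltz_pmod.
  by move: rR; rewrite mem_iota; lia.
have sfull : size full = m by rewrite size_map size_iota.
have saR : size aR = size R by rewrite size_map.
have Rm : (size R <= m)%N.
  rewrite -sfull; apply: uniq_leq_size => // r /bR hr.
  by apply/mapP; exists `|r|%N; [rewrite mem_iota; lia | lia].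
have fkm : coprimez m%:Z f`_k by rewrite coprimez_sym.
have [A [uA sA bA dA]] := digit_seq n m1 uD bD.
exists A; split=> //; last first.
  have RP := restricted_prod n P k0 (introT andP (conj R0 Rm)).
  apply: leq_trans RP _; rewrite sA [(m ^ P.+1)%N]expnSr mulnCA leq_mul2l.
  apply/orP; right.
  (* Digit 0 is fixed; the factor [m] at [j = 0] pays for it and accounts for the exponent
     [P.+1]. *)
  have leD j : ((if c j then size R else m) <=
                size (D j) * (if j == 0 then m else 1))%N.
    rewrite /D; case: (j == 0)%N; first by rewrite mul1n; case: ifP.
    by rewrite muln1; case: ifP => _; rewrite ?saR ?sfull.
  apply: (@leq_trans
    (\prod_(0 <= j < n) (size (D j) * (if j == 0 then m else 1)))%N).
    by apply: leq_prod => j _; exact: leD.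
  rewrite big_split leq_mul2l; apply/orP; right.
  case: (n) => [|n']; first by rewrite big_nil.
  by rewrite big_nat_recl // big1 /= ?muln1.
move=> a a' x aA a'A axE; apply/eqP; apply: contraT => aa'.
have [j [b [b' [q [jn bDj b'Dj bb' e]]]]] := dA _ _ aA a'A aa'.
have mu : ~~ (m%:Z %| b - b' + m%:Z * q)%Z.
  rewrite rpredDr ?dvdz_mulr //; apply: contra bb' => h.
  by apply/eqP/dvd_small => //; [exact: bD bDj | exact: bD b'Dj].
have j0 : (0 < j)%N.
  rewrite lt0n; apply: contra bb' => /eqP j0.
  by move: bDj b'Dj; rewrite /D j0 /= !inE => /eqP-> /eqP->.
have mfx : (m%:Z %| f.[x])%Z.
  by rewrite -axE e -(prednK j0) exprS -mulrA dvdz_mulr.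
have fx0 : f.[x] != 0 by rewrite -axE subr_eq0.
have x0 : x != 0.
  apply: contraNneq fx0 => ->; rewrite fE horner_sum big_nat big1 // => i /andP[ki _].
  by rewrite hornerZ hornerXn expr0n; case: (i) ki => [|i' _]; [lia | rewrite mulr0].
have [i [y [xE my]]] := dvdz_max_exp m1 x0.
(* Agreement in digit 0 gave [m] dividing [f(x)], so the root hypothesis makes [m] divide [x]. *)
have i0 : (0 < i)%N.
  by case: (i) xE => // xE; move: (froot _ mfx); rewrite xE mul1r (negbTE my).
have [z fxE] := @horner_max_exp m _ _ _ _ y kd fE i0.
have mv : ~~ (m%:Z %| f`_k * y ^+ k + m%:Z * z)%Z.
  apply: contra my => /dvdzP[w wE]; apply: (squarefree_dvdz_exp (k := k) m0 sqm).
  rewrite -(Gauss_dvdzr _ fkm); apply/dvdzP; exists (w - z).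
  by rewrite mulrBl -wE; ring.
(* Both factorizations of [f(x)] have a cofactor not divisible by [m], so [j = k * i] and the
   cofactors agree. *)
move: (axE); rewrite e [in RHS]xE fxE => /(eq_max_exp m1 mu mv)[jE uE].
have iP : (i < P)%N.
  rewrite ltnS leq_divRL // -(leq_exp2l _ _ m1).
  have y1 : (0 < `|y|)%N.
    by rewrite absz_gt0; apply: contraNneq my => ->; rewrite dvdz0.
  have xd : (m ^ (i * d) <= `|x| ^ d)%N.
    by rewrite expnM leq_exp2r // xE abszM abszX leq_pmulr.
  apply: leq_trans xd _; rewrite addnC expnD.
  have := fC x fx0; rewrite -axE; move: (bA _ aA) (bA _ a'A) => ba ba' Cx.
  have am : (`|a - a'| <= m ^ n)%N.
    rewrite -lez_nat PoszX; move: ba ba'; clear; set M := _ ^+ n; lia.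
  apply: leq_trans (leq_mul Cmt am).
  by rewrite -lez_nat PoszM PoszX; exact: Cx.
have cj : c j by rewrite /c jE dvdn_mulr // mulKn.
move: bDj b'Dj bb'; rewrite /D -[j == 0%N]negbK -lt0n j0 /= cj.
move=> /mapP[r rR bE] /mapP[r' r'R b'E] bb'.
have rr' : r != r' by apply: contraNneq bb' => rr'; rewrite bE b'E rr'.
have := sepR _ _ rR r'R rr' y; rewrite eqz_mod_dvd.
rewrite -(Gauss_dvdzr _ fkm) => /negP[].
(* Lifting both digits back to [R] shows that [m] divides [f_k * (r - r' - y ^ k)], against the
   choice of [R]. *)
have [s bs] : exists s, f`_k * r = b + m%:Z * s.
  by exists (f`_k * r %/ m%:Z)%Z;
    rewrite {1}(divz_eq (f`_k * r) m%:Z) -bE; ring.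
have [s' bs'] : exists s, f`_k * r' = b' + m%:Z * s.
  by exists (f`_k * r' %/ m%:Z)%Z;
    rewrite {1}(divz_eq (f`_k * r') m%:Z) -b'E; ring.
apply/dvdzP; exists (s - s' + z - q).
rewrite !mulrBr bs bs'.
have -> : f`_k * y ^+ k = b - b' + m%:Z * q - m%:Z * z by rewrite uE; ring.
ring.
Qed.

(** * From the digit count to the exponent *)

(** The loss [t.+3] in the exponent of [m] has four sources: [t] from the growth constant, and 1
    each from [N <= m ^ n.+1], from fixing digit 0 and from rounding in [P]. *)
Lemma size_lower_bound (K : realType) (m r d n t S N : nat) :
  (1 < m)%N -> (0 < r <= m)%N -> (0 < d)%N ->
  (m ^ n * r ^ ((n + t) %/ d).+1 <= S * m ^ ((n + t) %/ d).+2)%N ->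
  (N <= m ^ n.+1)%N ->
  (m%:R ^- t.+3 : K) *
    (N%:R `^ ((d%:R - 1 + ln r%:R / ln m%:R) / d%:R)) <= S%:R.
Proof.
move=> m1 /andP[r0 rm] d0; set P := ((n + t) %/ d).+1 => SP Nm.
have mK1 : 1 < m%:R :> K by rewrite ltr1n.
have mK0 : 0 < m%:R :> K by lra.
have lnm : 0 < ln m%:R :> K by rewrite ln_gt0.
pose l : K := ln r%:R / ln m%:R.
have l0 : 0 <= l by rewrite divr_ge0 ?ln_ge0 ?ler1n //; lia.
have l1 : l <= 1.
  by rewrite ler_pdivrMr // mul1r ler_ln ?posrE ?ltr0n ?ler_nat //; lia.
have rE : r%:R = m%:R `^ l :> K.
  by rewrite /powR gt_eqF // /l divfK ?gt_eqF // lnK // posrE ltr0n.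
have dK : 1 <= d%:R :> K by rewrite ler1n.
rewrite -/l; set g := (_ / d%:R).
have g0 : 0 <= g by rewrite divr_ge0 //; lra.
(* About [n / d] digits each lose the share [1 - l] of a free digit. *)
have gE : g = 1 - (1 - l) / d%:R by rewrite /g; field; lra.
clearbody g.
have NK : N%:R `^ g <= m%:R `^ (n.+1%:R * g).
  rewrite [leRHS]powRrM powR_mulrn ?ler0n // -natrX.
  by apply: (ge0_ler_powR g0); rewrite ?nnegrE ?ler0n ?ler_nat.
have pD x y : m%:R `^ (x + y) = m%:R `^ x * m%:R `^ y :> K.
  by rewrite powRD // (gt_eqF mK0) implybT.
have SK : m%:R `^ (n%:R + l * P%:R - P.+1%:R) <= S%:R :> K.
  have pm x : 0 < m%:R `^ x :> K by rewrite powR_gt0.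
  rewrite -(ler_pM2r (pm P.+1%:R)) -pD subrK pD powRrM -rE !powR_mulrn ?ler0n // -!natrX -!natrM ler_nat.
  exact: SP.
apply: le_trans SK; apply: le_trans (ler_wpM2l _ NK) _.
  by rewrite invr_ge0 exprn_ge0 // ltW.
rewrite -powR_invn ?ler0n // -pD.
apply: ler_powR; first exact: ltW.
have Pd : P%:R <= (n%:R + t%:R) / d%:R + 1 :> K.
  rewrite /P -natr1 lerD2r ler_pdivlMr; last lra.
  by rewrite -natrM -natrD ler_nat leq_divM.
have td : t%:R / d%:R <= t%:R :> K.
  by rewrite ler_pdivrMr ?ler_peMr ?ler0n //; lra.
have : (1 - l) * P%:R <= (1 - l) * ((n%:R + t%:R) / d%:R + 1).
  by apply: ler_wpM2l => //; lra.
have t0 : 0 <= t%:R / d%:R :> K by rewrite divr_ge0.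
have : 0 <= (1 - l) / d%:R by rewrite divr_ge0 //; lra.
rewrite gE -!natr1; nra.
Qed.

(** * Arbitrary [N], and the shift into the interval from 1 to [N] *)

Theorem theorem1p6 (K : realType) (m k d : nat) (f : {poly int})
    (m_ge2 : (2 <= m)%N) (m_sqfree : squarefree m)
    (k_ge2 : (2 <= k)%N) (k_le_d : (k <= d)%N)
    (f_def : f = \sum_(k <= i < d.+1) f`_i *: 'X^i)
    (f_lead : f`_d != 0)
    (f_low : coprimez f`_k m%:Z)
    (f_root : forall x : int, (m%:Z %| f.[x])%Z -> (m%:Z %| x)%Z) :
  exists c : K, 0 < c /\
    forall R : {set 'I_m},
      (forall r r' : 'I_m, r \in R -> r' \in R -> r != r' ->
         forall x : int, ((r : nat)%:Z - (r' : nat)%:Z != x ^+ k %[mod m%:Z])%Z) ->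
      forall N : nat, (0 < N)%N ->
        exists A : {fset int},
          [/\ (forall a : int, a \in A -> 1 <= a <= N%:Z),
              difference_set A `&` value_set f = [set 0] &
              c * (N%:R `^ gamma_exponent K d R) <= (#|` A|)%:R].
Proof.
have d0 : (0 < d)%N by lia.
have sf : size f = d.+1.
  apply/eqP; rewrite eqn_leq; apply/andP; split; last first.
    by rewrite ltnNge; apply: contra f_lead => h; rewrite nth_default.
  rewrite f_def big_nat; apply: leq_trans (size_sum _ _ _) _.
  apply/bigmax_leqP_seq => i _ /andP[_ id].
  by apply: leq_trans (size_scale_leq _ _) _; rewrite size_polyXn.
have [C fC] := horner_growth sf d0.
(* Taking [t = C] fixes the constant in terms of [m] and [f] alone, before [R] is chosen. *)
have Ct : (C <= m ^ C)%N by apply/ltnW/ltn_expl.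
exists (m%:R ^- C.+3); split.
  by rewrite invr_gt0 exprn_gt0 // ltr0n; lia.
move=> R sepR N N0.
have f00 : f.[0] = 0.
  rewrite f_def horner_sum big_nat big1 // => i /andP[ki _].
  by rewrite hornerZ hornerXn expr0n; case: (i) ki => [|i' _]; [lia | rewrite mulr0].
(* An empty [R] is replaced by the digit set [[:: 0]]; the exponent is unchanged since
   [ln 0 = 0 = ln 1]. *)
have [Q [uQ bQ Q0 sepQ lnQ]] : exists Q : seq int,
    [/\ uniq Q, forall r, r \in Q -> 0 <= r < m%:Z, (0 < size Q)%N,
        forall r r', r \in Q -> r' \in Q -> r != r' ->
          forall x : int, (r - r' != x ^+ k %[mod m%:Z])%Z &
        ln #|R|%:R = ln (size Q)%:R :> K].
  have [->|Rne] := eqVneq R finset.set0.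
    exists [:: 0]; split=> //.
    - by move=> r; rewrite inE => /eqP->; lia.
    - by move=> r r'; rewrite !inE => /eqP-> /eqP->; rewrite eqxx.
    - by rewrite cards0 ln0 ?ln1.
  exists [seq (i : nat)%:Z | i : 'I_m <- enum R]; split.
  - by rewrite map_inj_uniq ?enum_uniq // => i j [] /val_inj.
  - by move=> _ /mapP[i _ ->]; have := ltn_ord i; lia.
  - by rewrite size_map -cardE card_gt0.
  - move=> _ _ /mapP[i iR ->] /mapP[j jR ->] ij.
    rewrite !mem_enum in iR jR.
    by apply: (sepR i j iR jR); apply: contraNneq ij => ->.
  - by rewrite size_map -cardE.
set n := trunc_log m N.
have nN : (m ^ n <= N)%N by apply: trunc_logP.
have Nn : (N < m ^ n.+1)%N by apply: trunc_log_ltn.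
have [A [uA bA freeA sA]] := polynomial_free_seq n m_ge2 m_sqfree (ltnW k_ge2)
  k_le_d f_def f_low f_root fC Ct uQ bQ Q0 sepQ.
have Qm : (0 < size Q <= m)%N.
  rewrite Q0 -[leqRHS](size_iota 0 m) -[leqRHS](size_map Posz).
  apply: uniq_leq_size => // r /bQ hr.
  by apply/mapP; exists `|r|%N; [rewrite mem_iota; lia | lia].
have low := @size_lower_bound K _ _ _ _ _ _ _ m_ge2 Qm d0 sA (ltnW Nn).
(* The shift moves [A] from [0 <= a < m ^ n] into the range from 1 to [N] and keeps all
   differences. *)
pose B := [seq a + 1 | a <- A].
have uB : uniq B by rewrite map_inj_uniq // => a b /addIr.
(* Nonemptiness is what puts 0 among the differences. *)
have A0 : (0 < size A)%N.
  rewrite lt0n; apply: contraTneq sA => ->.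
  by rewrite mul0n -ltnNge muln_gt0 !expn_gt0 Q0; lia.
exists [fset x in B]%fset; split.
- move=> x; rewrite inE => /mapP[a /bA + ->].
  move: nN; rewrite -lez_nat PoszX; clear; set M := _ ^+ n; lia.
- apply/seteqP; split=> x /=.
    case=> -[u [v [+ + xE]]] [y _ yx].
    rewrite !inE => /mapP[a aA uE] /mapP[b bA' vE].
    move: xE; rewrite uE vE opprD addrACA subrr addr0 -yx => abE.
    by rewrite abE (freeA _ _ _ aA bA' (esym abE)) subrr.
  move=> ->; split; last by exists 0.
  have aA := mem_nth 0 A0; exists (nth 0 A 0 + 1), (nth 0 A 0 + 1).
  by split; rewrite ?subrr // inE; apply/mapP; exists (nth 0 A 0).
by rewrite /gamma_exponent lnQ card_fseq undup_id // size_map.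
Qed.
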